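(* Let $f\in\mathcal{F}_L(\mathbb{R}_+^N)$, suppose $\nabla f$ is $B$-bounded, and let $x(0)\in\mathbb{R}_+^N$. Then for any $\epsilon>0$ there exist a step-size $\gamma>0$ and $T\in\mathbb{N}$ such that the iterates generated by $$x(t+1)=\left\lceil x(t)-\frac{\gamma}{\sqrt{N}}\,\mathrm{sign}(\nabla f(x(t)))\right\rceil^+,\qquad t=0,1,2,\ldots$$ satisfy $f(x(t))-f^\star\leq\epsilon$ for all $t\geq T$.
   Context: $\mathbb{R}_+=[0,\infty)$, $N\geq1$, $L>0$, $B>0$, and $\|\cdot\|$ is the Euclidean norm. $\lceil\cdot\rceil^+$ denotes the (componentwise) projection onto $\mathbb{R}_+^N$, i.e. $(\lceil x\rceil^+)_i=\max\{x_i,0\}$. $\mathrm{sign}$ acts componentwise with values in $\{-1,1\}$: $\mathrm{sign}(z)=1$ if $z>0$, $\mathrm{sign}(z)=-1$ if $z<0$, and $\mathrm{sign}(0)\in\{-1,1\}$ is an arbitrary fixed value. Class $\mathcal{F}_L(\mathbb{R}_+^N)$: $f\in\mathcal{F}_L(\mathbb{R}_+^N)$ means $f:\mathbb{R}^N\to\mathbb{R}$ is convex and differentiable with $L$-Lipschitz continuous gradient, and the solution set $\mathcal{X}^\star$ of the problem of minimizing $f(x)$ subject to $x\in\mathbb{R}_+^N$ is nonempty and bounded; $f^\star$ is the optimal value of this problem. $\nabla f$ is $B$-bounded if $\|\nabla f(x)\|\leq B$ for all $x\in\mathbb{R}_+^N$. *)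

(* Defs.v *)
From HB Require Import structures.
From mathcomp Require Import all_boot all_order all_algebra.
From mathcomp Require Import all_classical all_reals all_analysis.

Set Implicit Arguments.
Unset Strict Implicit.
Unset Printing Implicit Defensive.

Import Order.TTheory GRing.Theory Num.Theory.
Import numFieldNormedType.Exports.

Local Open Scope classical_set_scope.
Local Open Scope ring_scope.

Section defs.
Context {R : realType} {N : nat}.
Implicit Types (x y z : 'rV[R]_N) (f : 'rV[R]_N -> R).

(* The norm [`|x|] on ['rV[R]_N] is the sup norm, whence a separate Euclidean
   norm. *)
Definition enorm x : R := Num.sqrt (\sum_i x 0 i ^+ 2).

Definition nonneg_orthant : set 'rV[R]_N := [set x | forall i, 0 <= x 0 i].

Definition proj_orthant x : 'rV[R]_N := \row_i Num.max (x 0 i) 0.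

(* The directional derivatives are total (junk where [f] is not derivable), so
   this is the gradient only where [f] is differentiable. *)
Definition gradient f x : 'rV[R]_N := \row_i 'D_(delta_mx 0 i) f x.

(* [s0] is the value of the sign at 0, to be taken in {-1, 1}. *)
Definition sign_at (s0 a : R) : R :=
  if 0 < a then 1 else if a < 0 then -1 else s0.

Definition sign_vec (s0 : R) z : 'rV[R]_N := map_mx (sign_at s0) z.

Definition solution_set f : set 'rV[R]_N :=
  [set x | nonneg_orthant x /\
           forall y, nonneg_orthant y -> f x <= f y].

Definition optimal_value f : R := inf (f @` nonneg_orthant).

(* [differentiable] and [bounded_set] refer to the sup norm, but in finite
   dimension neither depends on the choice of the norm. *)
Record smooth_class (L : R) f : Prop := SmoothClass {
  smooth_convex : convex_function [set: 'rV[R]_N] f;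
  smooth_differentiable : forall x, differentiable f x;
  smooth_lipschitz : forall x y,
    enorm (gradient f x - gradient f y) <= L * enorm (x - y);
  smooth_solution_nonempty : solution_set f !=set0;
  smooth_solution_bounded : bounded_set (solution_set f)
}.

Definition gradient_bounded (B : R) f : Prop :=
  forall x, nonneg_orthant x -> enorm (gradient f x) <= B.

Definition sign_step (s0 gamma : R) f x : 'rV[R]_N :=
  proj_orthant
    (x - (gamma / Num.sqrt (N%:R : R)) *: sign_vec s0 (gradient f x)).

Definition iterate (s0 gamma : R) f x (t : nat) : 'rV[R]_N :=
  iter t (sign_step s0 gamma f) x.

End defs.

(* Main.v *)
Require Import Defs.
From mathcomp Require Import all_boot all_order all_algebra.
From mathcomp Require Import all_classical all_reals all_analysis.
From mathcomp Require Import ring lra.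
Import Order.TTheory GRing.Theory Num.Theory.
Import numFieldNormedType.Exports.
Local Open Scope classical_set_scope.
Local Open Scope ring_scope.

(** Fix a minimizer xs of f on the orthant and write a for the gap f x - f xs
    along the iteration; every coordinate moves by at most d, the step-size
    divided by the square root of N.

    The sign step keeps the gap under control as long as the iterates stay
    bounded.  Suppose that the coordinates of x and xs lie in [0, D] and put
    d = th * D with th <= 1.  Each coordinate then decreases the linearization
    of f at x by at least the fraction th of what moving that coordinate to its
    value at xs would achieve, also where the projection cuts the move short
    ([sign_coordinate_progress]).  Summing over the coordinates, convexity gives
    a first-order decrease of at least th * a, and the Lipschitz gradient
    adds at most L * N * (th * D)^2 ([convex_lipschitz_descent]), so that

      a' <= (1 - th) * a + L * N * (th * D)^2   ([sign_step_contraction]).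

    The bound D exists because a convex function whose minimizers form a
    nonempty bounded set has bounded sublevel sets ([convex_sublevel_bounded]).
    Take D for the sublevel set of height A, the maximum of the initial gap and
    eps.  For th small enough the residual is at most th * (eps / 2).  Since
    eps / 2 <= A, the recursion then preserves a <= A, which makes it valid at
    every step, and it brings a below eps at a geometric rate
    ([eventually_le_of_contraction]). *)

(** * Convexity and gradients *)

Lemma convex_function_segment {R : realType} {E : lmodType R} (f : E -> R)
    (x y : E) (t : R) :
  convex_function [set: E] f -> 0 <= t <= 1 ->
  f (x + t *: (y - x)) <= f x + t * (f y - f x).
Proof.
move=> cf /andP[t0 t1].
pose p : {i01 R} := Itv01 t0 t1.
have := cf p y x; rewrite !inE => /(_ Logic.I Logic.I).
rewrite /conv /=.
have -> : (p%:num *: y + (1 - p%:num) *: x : E) = x + t *: (y - x).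
  by rewrite scalerBl scale1r scalerBr addrCA addrA /=.
move=> h; apply: (le_trans h).
rewrite (_ : _ + _ = t * f y + (1 - t) * f x) //; ring.
Qed.

Lemma derive_gradient {R : realType} {N : nat} (f : 'rV[R]_N -> R)
    (x v : 'rV[R]_N) :
  differentiable f x -> 'D_v f x = \sum_i gradient f x 0 i * v 0 i.
Proof.
move=> df; rewrite deriveE // {1}[v]row_sum_delta linear_sum.
apply: eq_bigr => i _.
by rewrite linearZ /= mxE deriveE // mulrC.
Qed.

(** The difference quotients of [f] at [x] towards [y] with step at most 1 are
    bounded by [f y - f x], hence so is their limit from the right. *)
Lemma convex_gradient_le {R : realType} {N : nat} (f : 'rV[R]_N -> R)
    (x y : 'rV[R]_N) :
  convex_function [set: 'rV[R]_N] f -> differentiable f x ->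
  f x + \sum_i gradient f x 0 i * (y - x) 0 i <= f y.
Proof.
move=> cf df; rewrite -derive_gradient // -lerBrDl.
have /cvg_dnbhs_at_right h := @diff_derivable _ _ _ f x (y - x) df.
apply: (cvgr_to_le h).
near=> t.
have t0 : 0 < t by near: t; exact: nbhs_right_gt.
have t1 : t <= 1 by near: t; exact: nbhs_right_le.
rewrite /= /GRing.scale /= ler_pdivrMl // lerBlDl [_ *: _ + x]addrC.
by apply: convex_function_segment => //; rewrite (ltW t0) t1.
Unshelve. all: by end_near.
Qed.

(** Weighted arithmetic-geometric means on each coordinate,
    2 u_i v_i <= u_i^2 / L + L v_i^2, are sharp enough here: by the hypothesis
    the first terms have at most the same sum as the second ones. *)
Lemma dot_le_of_enorm {R : realType} {N : nat} (u v : 'rV[R]_N) (L : R) :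
  0 < L -> enorm u <= L * enorm v ->
  \sum_i u 0 i * v 0 i <= L * \sum_i v 0 i ^+ 2.
Proof.
move=> L0 huv.
have s0 (w : 'rV[R]_N) : 0 <= \sum_i w 0 i ^+ 2.
  by apply: sumr_ge0 => i _; exact: sqr_ge0.
have {huv}uv : \sum_i u 0 i ^+ 2 <= L ^+ 2 * \sum_i v 0 i ^+ 2.
  rewrite -(sqr_sqrtr (s0 u)) -(sqr_sqrtr (s0 v)) -exprMn.
  by rewrite lerXn2r // ?nnegrE ?mulr_ge0 ?sqrtr_ge0 ?ltW.
have amgm : \sum_i u 0 i * v 0 i <=
    2^-1 * (L^-1 * \sum_i u 0 i ^+ 2 + L * \sum_i v 0 i ^+ 2).
  rewrite !mulr_sumr -big_split /= mulr_sumr; apply: ler_sum => i _.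
  set a := u 0 i; set b := v 0 i.
  rewrite -subr_ge0 [X in 0 <= X](_ : _ = 2^-1 * L^-1 * (a - L * b) ^+ 2).
    by rewrite mulr_ge0 ?sqr_ge0 // mulr_ge0 ?invr_ge0 // ltW.
  by field; rewrite gt_eqF.
apply: (le_trans amgm); rewrite ler_pdivrMl // mulr_natl mulr2n lerD2r.
by rewrite ler_pdivrMl // mulrA -expr2.
Qed.

(** A descent lemma with constant L in place of the usual L / 2, in exchange
    for which convexity replaces integration along the segment: it bounds
    [f y - f x] by the slope at [y], which the Lipschitz condition compares
    with the slope at [x]. *)
Lemma convex_lipschitz_descent {R : realType} {N : nat} (f : 'rV[R]_N -> R)
    (L : R) (x y : 'rV[R]_N) :
  0 < L -> smooth_class L f ->
  f y <= f x + \sum_i gradient f x 0 i * (y - x) 0 i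
             + L * \sum_i (y - x) 0 i ^+ 2.
Proof.
move=> L0 [cf df lf _ _].
have lip := dot_le_of_enorm _ _ _ L0 (lf y x).
have cvx := convex_gradient_le f y x cf (df y).
have dotE : \sum_i (gradient f y - gradient f x) 0 i * (y - x) 0 i
    = - \sum_i gradient f y 0 i * (x - y) 0 i
      - \sum_i gradient f x 0 i * (y - x) 0 i.
  rewrite -!sumrN -big_split /=; apply: eq_bigr => i _.
  rewrite [(y - x) 0 i]mxE [(x - y) 0 i]mxE [(_ - gradient f x) 0 i]mxE.
  by rewrite ![(- _ : 'rV_N) 0 i]mxE; ring.
by move: lip; rewrite dotE; lra.
Qed.

(** * Boundedness of sublevel sets *)

(** On the part of [C] in a sphere around [xs] beyond all minimizers, [f]
    exceeds its minimum by some m > 0 by compactness, so along rays of [C] from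
    [xs] convexity makes [f] grow at least linearly outside that sphere, with
    slope m over the radius. *)
Lemma convex_sublevel_bounded {R : realType} {N : nat} (f : 'rV[R]_N -> R)
    (C : set 'rV[R]_N) (xs : 'rV[R]_N) (A : R) :
  convex_function [set: 'rV[R]_N] f -> continuous f ->
  closed C ->
  (forall x y t, C x -> C y -> 0 <= t <= 1 -> C (x + t *: (y - x))) ->
  C xs -> (forall y, C y -> f xs <= f y) ->
  bounded_set [set x | C x /\ forall y, C y -> f x <= f y] ->
  exists2 D, 0 < D & forall x, C x -> f x <= f xs + A -> `|x| <= D.
Proof.
move=> cf ctf clC cvC Cxs minxs [M0 [_ bM0]].
pose M := Num.max M0 0 + 1.
have M_gt0 : 0 < M by rewrite ltr_wpDl // le_max lexx orbT.
have bM x : C x -> f x <= f xs -> `|x| <= M.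
  move=> Cx fx; apply: (bM0 M); first by rewrite ltr_pwDr // le_max lexx.
  by split=> // y Cy; apply: le_trans (minxs y Cy).
have xsM : `|xs| <= M by exact: bM.
(* Points at distance r from xs have norm at least r - M > M, so they are not
   minimizers. *)
pose r := 2 * M + 1.
have r_gt0 : 0 < r by rewrite /r; lra.
pose S := [set x | C x /\ `|x - xs| = r].
have toS x : C x -> r <= `|x - xs| ->
    S (xs + (r / `|x - xs|) *: (x - xs)).
  move=> Cx rx; have x_gt0 := lt_le_trans r_gt0 rx; split.
    by apply: cvC => //; rewrite divr_ge0 ?(ltW r_gt0) //= ler_pdivrMr // mul1r.
  rewrite addrAC subrr add0r normrZ normrM normfV normr_id.
  by rewrite (gtr0_norm r_gt0) divfK // gt_eqF.
(* If C does not meet the sphere, it lies inside by convexity. *)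
have [[s Ss]|S0] := pselect (S !=set0); last first.
  exists (M + r) => [|x Cx _]; first by rewrite addr_gt0.
  rewrite -(subrKC xs x) (le_trans (ler_normD _ _)) // lerD //.
  rewrite leNgt; apply/negP => /ltW rx.
  exact/S0/(ex_intro _ _ (toS x Cx rx)).
have ctd : continuous (fun x : 'rV[R]_N => `|x - xs|).
  move=> x.
  have cvid : {for x, continuous (@id 'rV[R]_N)} by exact: cvg_id.
  have ccst : {for x, continuous (@cst 'rV[R]_N 'rV[R]_N xs)}.
    by move=> ?; exact: cst_continuous.
  have csub : {for x, continuous (fun z : 'rV[R]_N => z - xs)}.
    exact: (continuousB cvid ccst).
  have := @continuous_comp _ _ _ _ _ _ csub (@norm_continuous R 'rV[R]_N _).
  exact.
have cptS : compact S.
  apply: bounded_closed_compact.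
    exists (M + r); split; first exact: num_real.
    move=> D MrD x [_ xr]; apply: le_trans (ltW MrD).
    by rewrite -(subrKC xs x) (le_trans (ler_normD _ _)) // xr lerD.
  apply: closedI => //.
  apply: (preimage_closed (f := fun x : 'rV[R]_N => `|x - xs|)
    (D := [set r])); last exact: closed_eq.
  by move=> x _; exact: ctd.
have [|||c /[!inE] -[Cc cr] minc] := @EVT_min_rV _ _ f S.
- by exists s.
- exact: cptS.
- exact: continuous_subspaceT.
have fc : 0 < f c - f xs.
  rewrite subr_gt0 ltNge; apply/negP => /(bM c Cc) cM.
  have := ler_normB c xs; rewrite cr /r; lra.
have q_ge0 : 0 <= r * `|A| / (f c - f xs).
  by rewrite !mulr_ge0 ?normr_ge0 ?invr_ge0 // ltW.
exists (M + (r + r * `|A| / (f c - f xs))) => [|x Cx fx].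
  by rewrite addr_gt0 // ltr_wpDr.
rewrite -(subrKC xs x) (le_trans (ler_normD _ _)) // lerD //.
have [rx|xr] := leP r `|x - xs|; last by rewrite (le_trans (ltW xr)) // lerDl.
have x_gt0 := lt_le_trans r_gt0 rx.
apply: (@le_trans _ _ (r * `|A| / (f c - f xs))); last by rewrite lerDr ltW.
set t := r / `|x - xs|.
have t01 : 0 <= t <= 1.
  by rewrite divr_ge0 ?(ltW r_gt0) //= ler_pdivrMr // mul1r.
have low : f c <= f (xs + t *: (x - xs)) by exact/minc/mem_set/toS.
have up := convex_function_segment f xs x t cf t01.
have fxA : f x - f xs <= `|A|.
  by rewrite lerBlDl (le_trans fx) // lerD2l ler_norm.
have tA : t * (f x - f xs) <= t * `|A| by rewrite ler_wpM2l //; case/andP: t01.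
have : f c - f xs <= r * `|A| / `|x - xs|.
  by rewrite mulrAC -/t; lra.
by rewrite !ler_pdivlMr // mulrC.
Qed.

Lemma nonneg_orthant_sublevel_bounded {R : realType} {N : nat}
    (f : 'rV[R]_N -> R) (L A : R) (xs : 'rV[R]_N) :
  smooth_class L f -> solution_set f xs ->
  exists2 D, 0 < D & forall x, nonneg_orthant x -> f x <= f xs + A ->
    forall i, 0 <= x 0 i <= D.
Proof.
move=> hf [xs0 xsmin].
have ctf : continuous f.
  move=> x; apply: differentiable_continuous.
  exact: smooth_differentiable hf x.
have clO : closed (@nonneg_orthant R N).
  rewrite (_ : nonneg_orthant = \bigcap_i [set x : 'rV[R]_N | 0 <= x 0 i]);
    last first.
    by apply/seteqP; split => x h i; [move=> _; exact: h|exact: (h i Logic.I)].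
  apply: closed_bigI => i _.
  apply: (preimage_closed (f := fun x : 'rV[R]_N => x 0 i)
    (D := [set z | 0 <= z])).
    by move=> x _; exact: coord_continuous.
  exact: closed_ge.
have cvO (x y : 'rV[R]_N) (t : R) : nonneg_orthant x -> nonneg_orthant y ->
    0 <= t <= 1 -> nonneg_orthant (x + t *: (y - x)).
  move=> hx hy /andP[t0 t1] i; rewrite !mxE.
  have -> : x 0 i + t * (y 0 i - x 0 i) = (1 - t) * x 0 i + t * y 0 i by ring.
  by rewrite addr_ge0 // mulr_ge0 // subr_ge0.
have [D D0 hD] := convex_sublevel_bounded f nonneg_orthant xs A
  (smooth_convex hf) ctf clO cvO xs0 xsmin (smooth_solution_bounded hf).
exists D => // x x0 fx i; rewrite x0 /=.
apply: le_trans (hD x x0 fx); rewrite -[leLHS]ger0_norm //.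
rewrite -[leRHS]/(mx_norm x) mx_normrE.
exact: (@le_bigmax _ _ _ _ (fun ij => `|x ij.1 ij.2|) (0, i)).
Qed.

(** * One step of the sign iteration *)

(** With the step written as [th * D], each coordinate gains at least the
    fraction [th] of what the linearization would gain by moving to [xs].
    If [0 < g] the move is [- (th * D)], or [- x] when the projection is
    active, and [th * (x - xs)] exceeds neither [th * D] nor [x].  If [g < 0]
    the move is [th * D], at least [th * (xs - x)]. *)
Lemma sign_coordinate_progress {R : realType} (s0 g x xs D th : R) :
  0 <= x <= D -> 0 <= xs <= D -> 0 <= th <= 1 ->
  g * (Num.max (x - th * D * sign_at s0 g) 0 - x) <= th * (g * (xs - x)).
Proof.
move=> /andP[x0 xD] /andP[xs0 xsD] /andP[th0 th1]; rewrite /sign_at mulrCA.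
have thxs : 0 <= th * xs by exact: mulr_ge0.
have thx : th * x <= x by exact: ler_piMl.
have thD : 0 <= th * (D - x) by rewrite mulr_ge0 ?subr_ge0.
have thDs : 0 <= th * (D - xs) by rewrite mulr_ge0 ?subr_ge0.
have thx0 : 0 <= th * x by exact: mulr_ge0.
have [g0|g0|<-] := ltgtP 0 g; last by rewrite !mul0r.
  by rewrite ler_pM2l // mulr1 lerBlDr ge_max; apply/andP; split; lra.
by rewrite ler_nM2l // mulrN1 opprK max_l; lra.
Qed.

Lemma sign_coordinate_move {R : realType} (s0 g x d : R) :
  s0 = 1 \/ s0 = -1 -> 0 <= x -> 0 <= d ->
  (Num.max (x - d * sign_at s0 g) 0 - x) ^+ 2 <= d ^+ 2.
Proof.
move=> hs x0 d0.
have : sign_at s0 g = 1 \/ sign_at s0 g = -1.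
  by rewrite /sign_at; case: ifP => _; [left|case: ifP => _; [right|]].
move=> hs'; rewrite -real_normK ?num_real // lerXn2r ?nnegrE //.
rewrite ler_norml lerBrDr lerBlDr le_max ge_max.
by case: hs' => ->; lra.
Qed.

(** Summing the coordinatewise gains, the first-order decrease is at least
    [th] times [f x - f xs] by convexity at [x]; the quadratic term of the
    descent lemma is the residual, since each coordinate moves by at most
    [th * D]. The factor [Num.sqrt N%:R] cancels the normalization of the
    step. *)
Lemma sign_step_contraction {R : realType} {N : nat} (f : 'rV[R]_N -> R)
    (L s0 D th : R) (x xs : 'rV[R]_N) :
  (0 < N)%N -> 0 < L -> s0 = 1 \/ s0 = -1 -> smooth_class L f ->
  0 <= th <= 1 ->
  (forall i, 0 <= x 0 i <= D) -> (forall i, 0 <= xs 0 i <= D) ->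
  f (sign_step s0 (th * D * Num.sqrt N%:R) f x) - f xs
    <= (1 - th) * (f x - f xs) + L * N%:R * (th * D) ^+ 2.
Proof.
move=> N0 L0 hs0 hf th01 hx hxs.
set y := sign_step _ _ _ _; set g := gradient f x.
have yE i : (y - x) 0 i =
    Num.max (x 0 i - th * D * sign_at s0 (g 0 i)) 0 - x 0 i.
  by rewrite !mxE mulfK // sqrtr_eq0 -ltNge ltr0n.
have hd := convex_lipschitz_descent f L x y L0 hf.
have hg : \sum_i g 0 i * (y - x) 0 i <= th * \sum_i g 0 i * (xs - x) 0 i.
  rewrite mulr_sumr; apply: ler_sum => i _; rewrite yE !mxE.
  exact: sign_coordinate_progress.
have hm : \sum_i (y - x) 0 i ^+ 2 <= N%:R * (th * D) ^+ 2.
  rewrite mulr_natl -[X in _ *+ X]card_ord -sumr_const.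
  apply: ler_sum => i _; rewrite yE; apply: sign_coordinate_move => //.
    by case/andP: (hx i).
  case/andP: th01 => th0 _; case/andP: (hx i) => x0 xD.
  by rewrite mulr_ge0 // (le_trans x0).
have hc := convex_gradient_le f x xs (smooth_convex hf)
  (smooth_differentiable hf x).
have {}hc : th * \sum_i g 0 i * (xs - x) 0 i <= th * (f xs - f x).
  by rewrite ler_wpM2l ?lerBrDl //; case/andP: th01.
move: hm; rewrite -(ler_pM2l L0) mulrA => hm.
lra.
Qed.

Lemma nonneg_orthant_iterate {R : realType} {N : nat} (s0 gamma : R)
    (f : 'rV[R]_N -> R) (x : 'rV[R]_N) (t : nat) :
  nonneg_orthant x -> nonneg_orthant (iterate s0 gamma f x t).
Proof. by case: t => // t _ i; rewrite /iterate iterS mxE le_max lexx orbT. Qed.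

(** * Convergence *)

(** The recursion pushes [a] below any number above its fixed point [c].  It is
    only available below the level [A], which is preserved because [c <= A]:
    the step bound is then a convex combination of numbers at most [A]. *)
Lemma eventually_le_of_contraction {R : realType} (a : nat -> R)
    (th c A eps : R) :
  0 < th <= 1 -> c < eps -> c <= A ->
  a 0%N <= A ->
  (forall t, a t <= A -> a t.+1 <= (1 - th) * a t + th * c) ->
  exists T, forall t, (T <= t)%N -> a t <= eps.
Proof.
move=> /andP[th0 th1] ce cA a0 step.
have th'0 : 0 <= 1 - th by rewrite subr_ge0.
have aA t : a t <= A.
  elim: t => // t IH; apply: le_trans (step t IH) _.
  have -> : A = (1 - th) * A + th * A by ring.
  by rewrite lerD // ler_wpM2l // ltW.
have ageo t : a t <= c + (A - c) * (1 - th) ^+ t.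
  elim: t => [|t IH]; first by rewrite expr0 mulr1 subrKC.
  apply: le_trans (step t (aA t)) _.
  have -> : c + (A - c) * (1 - th) ^+ t.+1
      = (1 - th) * (c + (A - c) * (1 - th) ^+ t) + th * c.
    by rewrite exprS; ring.
  by rewrite lerD2r ler_wpM2l.
have : geometric (A - c) (1 - th) @ \oo --> 0.
  by apply: cvg_geometric; rewrite ger0_norm // ltrBlDr ltrDl.
move=> /cvgr_le /(_ (eps - c)); rewrite subr_gt0 => /(_ ce) [T _ hT].
exists T => t Tt; apply: le_trans (ageo t) _.
by rewrite -lerBrDl; exact: hT Tt.
Qed.

Lemma optimal_valueE {R : realType} {N : nat} (f : 'rV[R]_N -> R)
    (xs : 'rV[R]_N) : solution_set f xs -> optimal_value f = f xs.
Proof.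
move=> [xs0 xsmin]; apply/eqP; rewrite eq_le; apply/andP; split.
  apply: ge_inf; last by exists xs.
  by exists (f xs) => _ [y y0 <-]; exact: xsmin.
apply: lb_le_inf; first by exists (f xs), xs.
by move=> _ [y y0 <-]; exact: xsmin.
Qed.

Theorem theorem4 (R : realType) (N : nat) (hN : (1 <= N)%N)
    (L B : R) (hL : 0 < L) (hB : 0 < B)
    (s0 : R) (hs0 : s0 = 1 \/ s0 = -1)
    (f : 'rV[R]_N -> R) (hf : smooth_class L f)
    (hgrad : gradient_bounded B f)
    (x0 : 'rV[R]_N) (hx0 : nonneg_orthant x0) :
  forall eps : R, 0 < eps ->
  exists (gamma : R) (T : nat), 0 < gamma /\
    forall t : nat, (T <= t)%N ->
      f (iterate s0 gamma f x0 t) - optimal_value f <= eps.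
Proof.
move=> eps eps0; have [xs hxs] := smooth_solution_nonempty hf.
rewrite (optimal_valueE f xs hxs).
(* At least f x0 - f xs, so that x0 lies in the sublevel set, and at least
   eps, so that the steps do not leave it. *)
pose A := Num.max (f x0 - f xs) eps.
have epsA : eps <= A by rewrite le_max lexx orbT.
have [D D0 hD] := nonneg_orthant_sublevel_bounded f L A xs hf hxs.
have hxsD i : 0 <= xs 0 i <= D.
  by apply: hD; [case: hxs|rewrite lerDl (le_trans (ltW eps0))].
have N0 : 0 < N%:R :> R by rewrite ltr0n.
pose K := L * N%:R * D ^+ 2.
have K0 : 0 < K by rewrite !mulr_gt0 // exprn_gt0.
(* The residual error K * th ^+ 2 of one step must be at most th * (eps / 2),
   so that the iteration contracts towards eps / 2; th <= 1 keeps the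
   coordinate move th * D below D. *)
pose th := Num.min 1 (eps / 2 / K).
have th01 : 0 < th <= 1 by rewrite lt_min ltr01 !divr_gt0 //= ge_min lexx.
have [th0 th1] := andP th01.
have thK : th * K <= eps / 2 by rewrite -ler_pdivlMr // ge_min lexx orbT.
exists (th * D * Num.sqrt N%:R).
pose x := iterate s0 (th * D * Num.sqrt N%:R) f x0.
have [||||T hT] := @eventually_le_of_contraction R
  (fun t => f (x t) - f xs) th (eps / 2) A eps th01.
- by rewrite ltr_pdivrMr // ltr_pMr // ltr1n.
- by apply: le_trans epsA; rewrite ler_pdivrMr // ler_pMr // ler1n.
- by rewrite le_max lexx.
- move=> t; rewrite lerBlDl => xtA.
  have xD := hD (x t) (nonneg_orthant_iterate _ _ f x0 t hx0) xtA.
  have th01' : 0 <= th <= 1 by rewrite ltW.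
  apply: (le_trans (sign_step_contraction f L s0 D th (x t) xs
    hN hL hs0 hf th01' xD hxsD)).
  rewrite lerD2l (_ : _ * _ = th * (th * K)); last by rewrite /K; ring.
  by rewrite ler_wpM2l // ltW.
by exists T; split; [rewrite !mulr_gt0 // sqrtr_gt0|exact: hT].
Qed.
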